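(* Let $A\in\mathcal L$, $b\in\mathbb R^m$, with $Mx_\lambda\ne0$ (and, for statements about componentwise condition numbers, with every component of $Mx_\lambda$ nonzero). Suppose that the basis $\{S_1,\dots,S_k\}$ of $\mathcal L$ satisfies $|B|=\sum_{i=1}^k|\beta_i||S_i|$ for every $B=\sum_{i=1}^k\beta_iS_i\in\mathcal L$. Then $$m^{\mathsf{Reg}}_{\mathcal L}(A,b)\le m^{\mathsf{Reg}}(A,b)\qquad\text{and}\qquad c^{\mathsf{Reg}}_{\mathcal L}(A,b)\le c^{\mathsf{Reg}}(A,b).$$ For the structured normwise condition number, when $A$ is a Toeplitz or Hankel matrix (that is, $\mathcal L$ is the space of $m\times n$ Toeplitz matrices or the space of $m\times n$ Hankel matrices, with its standard basis $S_1,\dots,S_k$), we have $$\kappa^{\mathsf{Reg}}_{\mathcal L}(A,b)\le\sqrt2\,\max\left\{\max_{i=1,\dots,k}\|S_i\|_F,\,1\right\}\kappa^{\mathsf{Reg}}(A,b).$$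
   Context: Standing setting: $\lambda>0$ is fixed, $L\in\mathbb R^{p\times n}$ with $\mathrm{rank}(L)=p\le n\le m$, $A\in\mathbb R^{m\times n}$ with $\mathrm{rank}\begin{bmatrix}A\\ L\end{bmatrix}=n$, and $M\in\mathbb R^{l\times n}$ with $l\le n$. The Tikhonov regularized solution is $x_\lambda=(A^\top A+\lambda^2L^\top L)^{-1}A^\top b$. $\mathcal L$ is a linear subspace of $\mathbb R^{m\times n}$ of dimension $k$ with basis $S_1,\dots,S_k$; $g:\mathbb R^k\to\mathcal L$, $g(a)=\sum_{i=1}^k a_iS_i$; and $A=g(a)$. The standard basis of the space of $m\times n$ Toeplitz (resp. Hankel) matrices consists of the $k=m+n-1$ matrices with ones on a single diagonal (resp. antidiagonal) and zeros elsewhere. For perturbations $\Delta A\in\mathbb R^{m\times n}$, $\Delta b\in\mathbb R^m$, let $$\Delta x=\left[(A+\Delta A)^\top(A+\Delta A)+\lambda^2L^\top L\right]^{-1}(A+\Delta A)^\top(b+\Delta b)-x_\lambda .$$ Structured condition numbers (here $\Delta A=g(a+\Delta a)-g(a)$ with $\Delta a\in\mathbb R^k$): $$m^{\mathsf{Reg}}_{\mathcal L}(A,b)=\lim_{\epsilon\to0}\ \sup_{|\Delta a|\le\epsilon|a|,\ |\Delta b|\le\epsilon|b|}\frac{\|M\Delta x\|_\infty}{\epsilon\|Mx_\lambda\|_\infty},\qquad c^{\mathsf{Reg}}_{\mathcal L}(A,b)=\lim_{\epsilon\to0}\ \sup_{|\Delta a|\le\epsilon|a|,\ |\Delta b|\le\epsilon|b|}\frac1\epsilon\left\|\frac{M\Delta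 x}{Mx_\lambda}\right\|_\infty,$$ $$\kappa^{\mathsf{Reg}}_{\mathcal L}(A,b)=\lim_{\epsilon\to0}\ \sup_{\|[\Delta a;\Delta b]\|_2\le\epsilon\|[a;b]\|_2}\frac{\|M\Delta x\|_2}{\epsilon\|Mx_\lambda\|_2}.$$ Unstructured condition numbers ($\Delta A\in\mathbb R^{m\times n}$ arbitrary): $$m^{\mathsf{Reg}}(A,b)=\lim_{\epsilon\to0}\ \sup_{|\Delta A|\le\epsilon|A|,\ |\Delta b|\le\epsilon|b|}\frac{\|M\Delta x\|_\infty}{\epsilon\|Mx_\lambda\|_\infty},\qquad c^{\mathsf{Reg}}(A,b)=\lim_{\epsilon\to0}\ \sup_{|\Delta A|\le\epsilon|A|,\ |\Delta b|\le\epsilon|b|}\frac1\epsilon\left\|\frac{M\Delta x}{Mx_\lambda}\right\|_\infty,$$ $$\kappa^{\mathsf{Reg}}(A,b)=\lim_{\epsilon\to0}\ \sup_{\|[\Delta A,\,\Delta b]\|_F\le\epsilon\|[A,\,b]\|_F}\frac{\|M\Delta x\|_2}{\epsilon\|Mx_\lambda\|_2}.$$ In all limits $\epsilon\to0$ through positive values. Here $|\cdot|$ and $\le$ on vectors and matrices are entrywise, the quotient of two vectors is componentwise, $[x;y]$ stacks $x$ on top of $y$, $[A,b]$ is the matrix $A$ with the column $b$ appended, and $\|\cdot\|_F$ is the Frobenius norm. *)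

(* Defs.v *)
From HB Require Import structures.
From mathcomp Require Import all_boot all_order all_algebra.
From mathcomp Require Import all_classical all_reals all_analysis.

Set Implicit Arguments.
Unset Strict Implicit.
Unset Printing Implicit Defensive.

Import Order.TTheory GRing.Theory Num.Theory.
Import numFieldNormedType.Exports.

Local Open Scope classical_set_scope.
Local Open Scope ring_scope.

Section MatrixNotions.
Variable R : realType.

Definition absmx (m n : nat) (X : 'M[R]_(m, n)) : 'M[R]_(m, n) :=
  map_mx Num.norm X.

Definition lemx (m n : nat) (X Y : 'M[R]_(m, n)) : Prop :=
  forall i j, X i j <= Y i j.

Definition divmx (m n : nat) (X Y : 'M[R]_(m, n)) : 'M[R]_(m, n) :=
  \matrix_(i, j) (X i j / Y i j).

(* On column vectors this is the Euclidean norm.  The infinity norm of a column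
   vector is the library norm `|v|, the maximum of the absolute entries. *)
Definition frobenius (m n : nat) (X : 'M[R]_(m, n)) : R :=
  Num.sqrt (\sum_i \sum_j X i j ^+ 2).

Definition lincomb (m n k : nat) (S : k.-tuple 'M[R]_(m, n)) (a : 'cV[R]_k) :
    'M[R]_(m, n) :=
  \sum_(i < k) a i 0 *: tnth S i.

Definition is_toeplitz (m n : nat) (X : 'M[R]_(m, n)) : Prop :=
  forall (i i' : 'I_m) (j j' : 'I_n), (i + j' = i' + j)%N -> X i j = X i' j'.

Definition is_hankel (m n : nat) (X : 'M[R]_(m, n)) : Prop :=
  forall (i i' : 'I_m) (j j' : 'I_n), (i + j = i' + j')%N -> X i j = X i' j'.

(* The t-th matrix carries the diagonal i - j = t - (n - 1), 0 <= t < m + n - 1;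
   the equation is written without truncated subtraction. *)
Definition toeplitz_basis (m n : nat) : seq 'M[R]_(m, n) :=
  [seq \matrix_(i, j) (i + n.-1 == t + j)%N%:R | t <- iota 0 (m + n).-1].

Definition hankel_basis (m n : nat) : seq 'M[R]_(m, n) :=
  [seq \matrix_(i, j) (i + j == t)%N%:R | t <- iota 0 (m + n).-1].

(* The standard basis comes with no prescribed enumeration, hence perm_eq. *)
Definition standard_toeplitz (m n k : nat) (V : {vspace 'M[R]_(m, n)})
    (S : k.-tuple 'M[R]_(m, n)) : Prop :=
  (forall X, X \in V <-> is_toeplitz X) /\ perm_eq S (toeplitz_basis m n).

Definition standard_hankel (m n k : nat) (V : {vspace 'M[R]_(m, n)})
    (S : k.-tuple 'M[R]_(m, n)) : Prop :=
  (forall X, X \in V <-> is_hankel X) /\ perm_eq S (hankel_basis m n).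

End MatrixNotions.

Section Perturbations.
Variables (R : realType) (m n : nat).

Definition perturbation : Type := ('M[R]_(m, n) * 'cV[R]_m)%type.

Definition entrywise_pert (A : 'M[R]_(m, n)) (b : 'cV[R]_m) (eps : R) :
    set perturbation :=
  [set d | lemx (absmx d.1) (eps *: absmx A) /\
           lemx (absmx d.2) (eps *: absmx b)].

Definition normwise_pert (A : 'M[R]_(m, n)) (b : 'cV[R]_m) (eps : R) :
    set perturbation :=
  [set d | frobenius (row_mx d.1 d.2) <= eps * frobenius (row_mx A b)].

Definition struct_entrywise_pert (k : nat) (S : k.-tuple 'M[R]_(m, n))
    (a : 'cV[R]_k) (b : 'cV[R]_m) (eps : R) : set perturbation :=
  [set d | exists2 da : 'cV[R]_k,
             lemx (absmx da) (eps *: absmx a) /\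
             lemx (absmx d.2) (eps *: absmx b)
           & d.1 = lincomb S (a + da) - lincomb S a].

Definition struct_normwise_pert (k : nat) (S : k.-tuple 'M[R]_(m, n))
    (a : 'cV[R]_k) (b : 'cV[R]_m) (eps : R) : set perturbation :=
  [set d | exists2 da : 'cV[R]_k,
             frobenius (col_mx da d.2) <= eps * frobenius (col_mx a b)
           & d.1 = lincomb S (a + da) - lincomb S a].

End Perturbations.

Section ConditionNumbers.
Variables (R : realType) (m n p l : nat).
Variables (lambda : R) (L : 'M[R]_(p, n)) (M : 'M[R]_(l, n)).

(* invmx is the identity on singular matrices.  When (A; L) has full column
   rank the matrix inverted here is nonsingular for A and for all nearby
   matrices, so this convention does not affect the limits below. *)
Definition tikhonov (A : 'M[R]_(m, n)) (b : 'cV[R]_m) : 'cV[R]_n :=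
  invmx (A^T *m A + lambda ^+ 2 *: (L^T *m L)) *m A^T *m b.

Definition tikhonov_change (A : 'M[R]_(m, n)) (b : 'cV[R]_m)
    (d : perturbation R m n) : 'cV[R]_n :=
  tikhonov (A + d.1) (b + d.2) - tikhonov A b.

Definition mixed_ratio A b (eps : R) (d : perturbation R m n) : R :=
  `|M *m tikhonov_change A b d| / (eps * `|M *m tikhonov A b|).

Definition componentwise_ratio A b (eps : R) (d : perturbation R m n) : R :=
  eps^-1 * `|divmx (M *m tikhonov_change A b d) (M *m tikhonov A b)|.

Definition normwise_ratio A b (eps : R) (d : perturbation R m n) : R :=
  frobenius (M *m tikhonov_change A b d) /
  (eps * frobenius (M *m tikhonov A b)).

(* The suprema are taken in the extended reals: for eps not small they may be
   infinite. *)
Definition worst (ratio : R -> perturbation R m n -> R)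
    (pert : R -> set (perturbation R m n)) (eps : R) : \bar R :=
  ereal_sup [set (ratio eps d)%:E | d in pert eps].

Definition m_Reg_sup A b : R -> \bar R :=
  worst (mixed_ratio A b) (entrywise_pert A b).
Definition c_Reg_sup A b : R -> \bar R :=
  worst (componentwise_ratio A b) (entrywise_pert A b).
Definition kappa_Reg_sup A b : R -> \bar R :=
  worst (normwise_ratio A b) (normwise_pert A b).

Definition m_Reg A b : \bar R := lim (m_Reg_sup A b eps @[eps --> 0^'+]).
Definition c_Reg A b : \bar R := lim (c_Reg_sup A b eps @[eps --> 0^'+]).
Definition kappa_Reg A b : \bar R :=
  lim (kappa_Reg_sup A b eps @[eps --> 0^'+]).

Section Structured.
Variables (k : nat) (S : k.-tuple 'M[R]_(m, n)).

Definition m_Reg_struct_sup a b : R -> \bar R :=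
  worst (mixed_ratio (lincomb S a) b) (struct_entrywise_pert S a b).
Definition c_Reg_struct_sup a b : R -> \bar R :=
  worst (componentwise_ratio (lincomb S a) b) (struct_entrywise_pert S a b).
Definition kappa_Reg_struct_sup a b : R -> \bar R :=
  worst (normwise_ratio (lincomb S a) b) (struct_normwise_pert S a b).

Definition m_Reg_struct a b : \bar R :=
  lim (m_Reg_struct_sup a b eps @[eps --> 0^'+]).
Definition c_Reg_struct a b : \bar R :=
  lim (c_Reg_struct_sup a b eps @[eps --> 0^'+]).
Definition kappa_Reg_struct a b : \bar R :=
  lim (kappa_Reg_struct_sup a b eps @[eps --> 0^'+]).

End Structured.
End ConditionNumbers.

(* Main.v *)
Require Import Defs.
From HB Require Import structures.
From mathcomp Require Import all_boot all_order all_algebra.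
From mathcomp Require Import all_classical all_reals all_analysis.
From mathcomp Require Import ring lra.

Set Implicit Arguments.
Unset Strict Implicit.
Unset Printing Implicit Defensive.

Import Order.TTheory GRing.Theory Num.Theory.
Import numFieldNormedType.Exports.

Local Open Scope classical_set_scope.
Local Open Scope ring_scope.

(** Each of the six condition numbers is the limit, as [t] tends to 0 from
    above, of the supremum over [d] in [P t] of [t^-1 * N (change of x by d)].
    Here [N] is a seminorm on the solution space that absorbs [M] and the
    normalization by [M x], and the sets [P t] of admissible perturbations are
    the dilations of one bounded set [P 1].

    The Tikhonov solution is differentiable at [(A, b)], with derivative
    [D = tikhonov_diff]: the normal matrix [A^T A + lambda^2 L^T L] is
    invertible ([gram_unitmx]), remains invertible with a bounded inverse under
    small perturbations ([unitmx_perturbed], [perturbed_solve_le]), and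
    subtracting the two systems of normal equations leaves a remainder that is
    quadratic in the perturbation, uniformly on bounded sets
    ([tikhonov_change_expansion]).  Hence all the limits exist and equal the
    supremum of [N (D d)] over [d] in [P 1] ([worst_cvg]), and it only remains
    to compare the sets [P 1].

    In the entrywise case the assumption on the basis gives
    [|lincomb S da| <= |lincomb S a|] whenever [|da| <= |a|], so the structured
    set is contained in the unstructured one.  In the normwise case the Toeplitz
    and Hankel bases consist of 0-1 matrices with disjoint supports, so
    [|lincomb S a|_F^2 = \sum_t a_t^2 |S_t|_F^2] with every [|S_t|_F >= 1]
    ([frobenius_lincomb]).  With [C] the maximum of 1 and of the [|S_t|_F], the
    structured set is contained in [C] times the unstructured one
    ([struct_normwise_pert_bound]), and the homogeneity of [D] yields the bound
    with the factor [C], hence also with [sqrt 2 * C]. *)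

(** * Norms of matrices *)

Section MatrixNorm.
Variable R : realType.

Lemma entry_le_norm m n (X : 'M[R]_(m, n)) i j : `|X i j| <= `|X|.
Proof.
rewrite [leRHS]/Num.Def.normr /= mx_normrE.
by apply/bigmax_geP; right; exists (i, j).
Qed.

Lemma norm_le_entries m n (X : 'M[R]_(m, n)) c :
  0 <= c -> (forall i j, `|X i j| <= c) -> `|X| <= c.
Proof.
move=> c0 Xc; rewrite [leLHS]/Num.Def.normr /= mx_normrE.
by rewrite (bigmax_le _ c0) // => -[i j] _; exact: Xc.
Qed.

Lemma norm_trmx_le m n (X : 'M[R]_(m, n)) c : `|X| <= c -> `|X^T| <= c.
Proof.
move=> Xc; apply: norm_le_entries => [|i j]; first exact: le_trans Xc.
by rewrite mxE (le_trans (entry_le_norm _ _ _)).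
Qed.

Lemma norm_mulmx_le m n p (X : 'M[R]_(m, n)) (Y : 'M[R]_(n, p)) c d :
  `|X| <= c -> `|Y| <= d -> `|X *m Y| <= n%:R * c * d.
Proof.
move=> Xc Yd.
have c0 : 0 <= c by exact: le_trans Xc.
have d0 : 0 <= d by exact: le_trans Yd.
apply: norm_le_entries => [|i j]; first by rewrite !mulr_ge0.
rewrite mxE (le_trans (ler_norm_sum _ _ _)) //.
have -> : n%:R * c * d = \sum_(k < n) c * d.
  by rewrite sumr_const card_ord -mulrA mulr_natl.
apply: ler_sum => k _; rewrite normrM ler_pM //.
  exact: le_trans (entry_le_norm _ _ _) Xc.
exact: le_trans (entry_le_norm _ _ _) Yd.
Qed.

Lemma normD_le m n (X Y : 'M[R]_(m, n)) c d :
  `|X| <= c -> `|Y| <= d -> `|X + Y| <= c + d.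
Proof. by move=> Xc Yd; rewrite (le_trans (ler_normD _ _)) // lerD. Qed.

Lemma normB_le m n (X Y : 'M[R]_(m, n)) c d :
  `|X| <= c -> `|Y| <= d -> `|X - Y| <= c + d.
Proof. by move=> Xc Yd; rewrite normD_le // normrN. Qed.

(** A small perturbation [E] of an invertible [G] keeps the solution operator
    bounded: in [y = G^-1 (G + E) y - G^-1 E y] the last term has at most half
    the norm of [y] and is absorbed on the left. *)
Lemma perturbed_solve_le n (G E : 'M[R]_n) (y : 'cV[R]_n) :
  G \in unitmx -> n%:R * `|invmx G| * (n%:R * `|E|) <= 2^-1 ->
  `|y| <= 2 * (n%:R * `|invmx G| * `|(G + E) *m y|).
Proof.
move=> Gu small.
have yE : y = invmx G *m ((G + E) *m y) - invmx G *m (E *m y).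
  by rewrite -mulmxBr mulmxDl addrK mulKmx.
have : `|y| <= n%:R * `|invmx G| * `|(G + E) *m y| +
               n%:R * `|invmx G| * (n%:R * `|E| * `|y|).
  by rewrite {1}yE normB_le ?norm_mulmx_le.
have : n%:R * `|invmx G| * (n%:R * `|E|) * `|y| <= 2^-1 * `|y|.
  exact: ler_wpM2r.
rewrite (mulrA _ (n%:R * `|E|) `|y|); lra.
Qed.

Lemma unitmx_perturbed n (G E : 'M[R]_n) :
  G \in unitmx -> n%:R * `|invmx G| * (n%:R * `|E|) <= 2^-1 ->
  G + E \in unitmx.
Proof.
move=> Gu small; rewrite -unitmx_tr unitmxE unitfE; apply/negP => /det0P[v v0 vGE].
have GEv : (G + E) *m v^T = 0 by rewrite -(trmxK (G + E)) -trmx_mul vGE trmx0.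
have := perturbed_solve_le v^T Gu small.
rewrite GEv normr0 !mulr0 normr_le0 => /eqP vT0.
by move: v0; rewrite -[v]trmxK vT0 trmx0 eqxx.
Qed.

End MatrixNorm.

(** * First-order expansion of the Tikhonov solution *)

Section Expansion.
Variables (R : realType) (m n p : nat) (lambda : R) (L : 'M[R]_(p, n)).
Variables (A : 'M[R]_(m, n)) (b : 'cV[R]_m).

(** The regularized normal matrix. *)
Definition gram (B : 'M[R]_(m, n)) : 'M[R]_n :=
  B^T *m B + lambda ^+ 2 *: (L^T *m L).

Lemma mul_row_trE k (v : 'rV[R]_k) : (v *m v^T) 0 0 = \sum_j v 0 j ^+ 2.
Proof. by rewrite mxE; apply: eq_bigr => j _; rewrite mxE expr2. Qed.

Lemma row_eq0_of_sum_sqr k (v : 'rV[R]_k) : \sum_j v 0 j ^+ 2 = 0 -> v = 0.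
Proof.
move=> /eqP; rewrite psumr_eq0 => [/allP v0|j _]; last exact: sqr_ge0.
apply/rowP => j; rewrite mxE; apply/eqP; rewrite -sqrf_eq0.
exact: v0 (mem_index_enum j).
Qed.

(** If [v G = 0] then [v G v^T = |A v^T|^2 + lambda^2 |L v^T|^2] vanishes, so
    [v^T] lies in the kernel of [A] stacked on [L], which is trivial. *)
Lemma gram_unitmx : 0 < lambda -> \rank (col_mx A L) = n -> gram A \in unitmx.
Proof.
move=> l0 rk; rewrite unitmxE unitfE; apply/negP => /det0P[v v0 vG].
have : (v *m gram A *m v^T) 0 0 = 0 by rewrite vG mul0mx mxE.
have -> : v *m gram A *m v^T =
    (v *m A^T) *m (v *m A^T)^T + lambda ^+ 2 *: ((v *m L^T) *m (v *m L^T)^T).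
  by rewrite /gram mulmxDr mulmxDl -scalemxAr -scalemxAl !trmx_mul !trmxK !mulmxA.
rewrite mxE [X in _ + X]mxE !mul_row_trE.
have A0 : 0 <= \sum_j (v *m A^T) 0 j ^+ 2 by rewrite sumr_ge0 // => j _; exact: sqr_ge0.
have L0 : 0 <= \sum_j (v *m L^T) 0 j ^+ 2 by rewrite sumr_ge0 // => j _; exact: sqr_ge0.
have l20 : 0 < lambda ^+ 2 by rewrite exprn_gt0.
move=> /eqP; rewrite paddr_eq0 ?(mulr_ge0 (ltW l20) L0) //.
rewrite mulf_eq0 (gt_eqF l20) /=.
move=> /andP[/eqP/row_eq0_of_sum_sqr vA /eqP/row_eq0_of_sum_sqr vL].
have : v *m (col_mx A L)^T == 0 by rewrite tr_col_mx mul_mx_row vA vL row_mx0.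
by rewrite mulmx_free_eq0 ?(negPf v0) // /row_free mxrank_tr rk.
Qed.

(** Dilation of the data perturbation [d] by the factor [t]. *)
Definition scale_pert (t : R) (d : perturbation R m n) : perturbation R m n :=
  (t *: d.1, t *: d.2).

(** The derivative of [tikhonov] at [(A, b)], obtained by differentiating the
    normal equations [gram A *m x = A^T *m b]. *)
Definition tikhonov_diff (d : perturbation R m n) : 'cV[R]_n :=
  let x := tikhonov lambda L A b in
  invmx (gram A) *m (d.1^T *m (b - A *m x) + A^T *m (d.2 - d.1 *m x)).

Lemma tikhonov_diff_scale t d :
  tikhonov_diff (scale_pert t d) = t *: tikhonov_diff d.
Proof.
rewrite /tikhonov_diff /=.
by rewrite linearZ /= -scalemxAl -[(t *: d.1) *m _]scalemxAl -scalerBr -scalemxAr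
  -scalerDr -scalemxAr.
Qed.

Lemma gram_mul_tikhonov (B : 'M[R]_(m, n)) (c : 'cV[R]_m) :
  gram B \in unitmx -> gram B *m tikhonov lambda L B c = B^T *m c.
Proof. by move=> Bu; rewrite /tikhonov -mulmxA mulKVmx. Qed.

Lemma gram_add (dA : 'M[R]_(m, n)) :
  gram (A + dA) = gram A + (A^T *m dA + dA^T *m (A + dA)).
Proof.
rewrite /gram [(A + dA)^T]linearD /= mulmxDl !mulmxDr.
by rewrite -!addrA; congr (_ + _); rewrite [RHS]addrC -!addrA.
Qed.

(** Subtract the perturbed normal matrix times [x] from both sides of the
    perturbed normal equations. *)
Lemma tikhonov_change_eqn (d : perturbation R m n) :
  gram A \in unitmx -> gram (A + d.1) \in unitmx ->
  let x := tikhonov lambda L A b in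
  gram (A + d.1) *m tikhonov_change lambda L A b d =
  (A + d.1)^T *m (d.2 - d.1 *m x) + d.1^T *m (b - A *m x).
Proof.
move=> Gu G'u x; rewrite /tikhonov_change mulmxBr gram_mul_tikhonov // -/x.
rewrite gram_add mulmxDl gram_mul_tikhonov //.
rewrite [(A + d.1)^T]linearD /= !mulmxDl !mulmxDr !mulmxN.
rewrite !mulmxDl !mulmxA.
set X1 := A^T *m b; set X2 := A^T *m d.2; set X3 := d.1^T *m b.
set X4 := d.1^T *m d.2; set Y1 := A^T *m d.1 *m x.
set Y2 := d.1^T *m A *m x; set Y3 := d.1^T *m d.1 *m x.
by apply/matrixP => i j; rewrite !mxE; ring.
Qed.

(** Writing [y] for the change, [G] for the normal matrix and [E] for its
    perturbation, [y - D d = G^-1 (d.1^T (d.2 - d.1 x) - E y)], where [E] and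
    [y] are both of first order. *)
Lemma tikhonov_change_expansion (B : R) :
  gram A \in unitmx -> 0 <= B ->
  exists C delta : R, 0 < delta /\ forall t d, 0 < t < delta ->
    `|d.1| <= B -> `|d.2| <= B ->
    `|tikhonov_change lambda L A b (scale_pert t d) - t *: tikhonov_diff d|
      <= C * t ^+ 2.
Proof.
move=> Gu B0; set x := tikhonov lambda L A b; set g := `|invmx (gram A)|.
pose e := m%:R * `|A| * B + m%:R * B * (`|A| + B).
pose w := B + n%:R * B * `|x|.
pose r := m%:R * (`|A| + B) * w + m%:R * B * `|b - A *m x|.
pose h := n%:R * g * (n%:R * e).
(* For [t <= 1]: [|E| <= t e], [|d.2 - d.1 x| <= t w], and the residual of the
   perturbed system is at most [t r]; [h t <= 1/2] keeps it solvable. *)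
exists (n%:R * g * (m%:R * B * w + n%:R * e * (2 * (n%:R * g * r)))).
have e0 : 0 <= e by rewrite addr_ge0 // !mulr_ge0 // addr_ge0.
have g0 : 0 <= g by exact: normr_ge0.
have h0 : 0 <= h by rewrite /h !mulr_ge0.
exists (Num.min 1 (2 * (h + 1))^-1); split.
  by rewrite lt_min ltr01 /= invr_gt0 mulr_gt0 // ltr_wpDl.
move=> t d /andP[t0]; rewrite lt_min => /andP[t1 th] d1B d2B.
have th2 : h * t <= 2^-1.
  have h1 : 0 < 2 * (h + 1) by rewrite mulr_gt0 // ltr_wpDl.
  move: th; rewrite -[ltRHS]mul1r ltr_pdivlMr //; lra.
set d' := scale_pert t d.
have nt : forall k q (X : 'M[R]_(k, q)), `|X| <= B -> `|t *: X| <= t * B.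
  by move=> k q X XB; rewrite normrZ gtr0_norm // ler_pM2l.
have d1 : `|d'.1| <= t * B by exact: nt.
have d2 : `|d'.2| <= t * B by exact: nt.
have tB : t * B <= B by rewrite ler_piMl // ltW.
pose E := A^T *m d'.1 + d'.1^T *m (A + d'.1).
have AdB : `|A + d'.1| <= `|A| + B by rewrite normD_le // (le_trans d1).
have Ee : `|E| <= t * e.
  have -> : t * e = m%:R * `|A| * (t * B) + m%:R * (t * B) * (`|A| + B).
    by rewrite /e; ring.
  apply: normD_le; apply: norm_mulmx_le => //; exact: norm_trmx_le.
have small : n%:R * g * (n%:R * `|E|) <= 2^-1.
  apply: le_trans th2; have -> : h * t = n%:R * g * (n%:R * (t * e)).
    by rewrite /h; ring.
  by rewrite !ler_wpM2l // mulr_ge0.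
have G'u : gram (A + d'.1) \in unitmx by rewrite gram_add unitmx_perturbed.
set y := tikhonov_change lambda L A b d'.
have Gy := tikhonov_change_eqn Gu G'u; rewrite -/x -/y in Gy.
have ww : `|d'.2 - d'.1 *m x| <= t * w.
  have -> : t * w = t * B + n%:R * (t * B) * `|x| by rewrite /w; ring.
  by rewrite normB_le // norm_mulmx_le.
have rr : `|gram (A + d'.1) *m y| <= t * r.
  have -> : t * r = m%:R * (`|A| + B) * (t * w) + m%:R * (t * B) * `|b - A *m x|.
    by rewrite /r; ring.
  by rewrite Gy normD_le // norm_mulmx_le // norm_trmx_le.
have yy : `|y| <= t * (2 * (n%:R * g * r)).
  have := perturbed_solve_le y Gu small; rewrite -gram_add => /le_trans; apply.
  have -> : t * (2 * (n%:R * g * r)) = 2 * (n%:R * g * (t * r)) by ring.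
  by rewrite ler_pM2l // ler_wpM2l // mulr_ge0.
have -> : y - t *: tikhonov_diff d =
    invmx (gram A) *m (d'.1^T *m (d'.2 - d'.1 *m x) - E *m y).
  rewrite -tikhonov_diff_scale -/d' /tikhonov_diff -/x -{1}(mulKmx Gu y) -mulmxBr.
  congr (_ *m _); have -> : gram A *m y = gram (A + d'.1) *m y - E *m y.
    by rewrite gram_add -/E [X in _ = X - _]mulmxDl addrK.
  rewrite Gy [(A + d'.1)^T]linearD /= mulmxDl.
  by apply/matrixP => i j; rewrite !mxE; ring.
have -> : n%:R * g * (m%:R * B * w + n%:R * e * (2 * (n%:R * g * r))) * t ^+ 2 =
    n%:R * g * (m%:R * (t * B) * (t * w) +
                n%:R * (t * e) * (t * (2 * (n%:R * g * r)))) by ring.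
apply: norm_mulmx_le => //; apply: normB_le; apply: norm_mulmx_le => //.
exact: norm_trmx_le.
Qed.

End Expansion.

(** * Limits of worst-case ratios *)

Section Seminorm.
Variables (R : realType) (n : nat).

(** Subadditive and absolutely homogeneous functionals; nonnegativity and
    continuity follow. *)
Definition seminorm (N : 'cV[R]_n -> R) : Prop :=
  (forall u v, N (u + v) <= N u + N v) /\ (forall c u, N (c *: u) = `|c| * N u).

Variable N : 'cV[R]_n -> R.
Hypothesis semiN : seminorm N.

Lemma seminorm0 : N 0 = 0.
Proof. by have := semiN.2 0 0; rewrite scale0r normr0 mul0r. Qed.

Lemma seminormN u : N (- u) = N u.
Proof. by rewrite -scaleN1r semiN.2 normrN1 mul1r. Qed.

Lemma seminorm_ge0 u : 0 <= N u.
Proof. by have := semiN.1 u (- u); rewrite subrr seminorm0 seminormN; lra. Qed.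

Lemma seminorm_dist u v : `|N u - N v| <= N (u - v).
Proof.
have := semiN.1 (u - v) v; have := semiN.1 (v - u) u.
rewrite !subrK -(opprB u v) seminormN ler_norml => ? ?.
by apply/andP; split; lra.
Qed.

Lemma seminorm_sum (I : Type) (r : seq I) (F : I -> 'cV[R]_n) :
  N (\sum_(i <- r) F i) <= \sum_(i <- r) N (F i).
Proof.
elim: r => [|i r IHr]; first by rewrite !big_nil seminorm0.
by rewrite !big_cons (le_trans (semiN.1 _ _)) // lerD2l.
Qed.

(** In finite dimension a seminorm is bounded by its values on the standard
    basis. *)
Lemma seminorm_bounded : exists2 c, 0 <= c & forall u, N u <= c * `|u|.
Proof.
exists (\sum_i N (delta_mx i 0)).
  by rewrite sumr_ge0 // => i _; exact: seminorm_ge0.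
move=> u; have uE : u = \sum_i u i 0 *: delta_mx i 0.
  by rewrite [LHS]matrix_sum_delta; apply: eq_bigr => i _; rewrite big_ord1.
rewrite {1}uE (le_trans (seminorm_sum _ _)) // mulr_suml ler_sum // => i _.
by rewrite semiN.2 mulrC ler_wpM2l ?seminorm_ge0 // entry_le_norm.
Qed.

End Seminorm.

Section WorstCase.
Variables (R : realType) (m n p : nat) (lambda : R) (L : 'M[R]_(p, n)).
Variables (A : 'M[R]_(m, n)) (b : 'cV[R]_m).
Hypothesis Gu : gram lambda L A \in unitmx.

Local Notation D := (tikhonov_diff lambda L A b).

Lemma norm_tikhonov_diff_le B : exists c, forall d,
  `|d.1| <= B -> `|d.2| <= B -> `|D d| <= c.
Proof.
set x := tikhonov lambda L A b.
eexists => d d1 d2; rewrite /tikhonov_diff -/x.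
apply: norm_mulmx_le; first exact: lexx.
apply: normD_le; apply: norm_mulmx_le; [exact: norm_trmx_le d1|exact: lexx| |].
  exact: norm_trmx_le.
apply: normB_le; first exact: d2.
by apply: norm_mulmx_le; first exact: d1.
Qed.

(** If the sets of admissible perturbations are the dilations of one bounded
    set [P 1], the worst relative change tends to the supremum over [P 1] of
    the derivative: the first-order expansion is uniform on [P 1]. *)
Lemma worst_cvg (N : 'cV[R]_n -> R) (P : R -> set (perturbation R m n)) (B : R) :
  seminorm N ->
  (forall (t : R) d, 0 < t -> P t (scale_pert t d) <-> P 1 d) ->
  P 1 (0, 0) ->
  (forall d, P 1 d -> `|d.1| <= B /\ `|d.2| <= B) ->
  worst (fun t d => t^-1 * N (tikhonov_change lambda L A b d)) P t @[t --> 0^'+] -->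
    ereal_sup [set (N (D d))%:E | d in P 1].
Proof.
move=> semiN Pscale P10 PB.
have B0 : 0 <= B by case: (PB _ P10); rewrite normr0.
have [C [delta [delta0 exp]]] := tikhonov_change_expansion b Gu B0.
have [c c0 Nc] := seminorm_bounded semiN.
have [q Dq] := norm_tikhonov_diff_le B.
pose k := c * C.
have key t d : 0 < t < delta -> P 1 d ->
    `|t^-1 * N (tikhonov_change lambda L A b (scale_pert t d)) - N (D d)| <= k * t.
  move=> /[dup] tdelta /andP[t0 _] /PB[d1 d2].
  have -> : N (D d) = t^-1 * N (t *: D d).
    by rewrite semiN.2 gtr0_norm // mulKf // gt_eqF.
  rewrite -mulrBr normrM gtr0_norm ?invr_gt0 // ler_pdivrMl //.
  rewrite (le_trans (seminorm_dist semiN _ _)) // (le_trans (Nc _)) //.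
  have -> : t * (k * t) = c * (C * t ^+ 2) by rewrite /k; ring.
  by rewrite ler_wpM2l // exp.
set S := [set (N (D d))%:E | d in P 1].
have Sle : (ereal_sup S <= (c * q)%:E)%E.
  apply: ge_ereal_sup => _ [d /PB[d1 d2] <-]; rewrite lee_fin.
  by rewrite (le_trans (Nc _)) // ler_wpM2l // Dq.
have Sge : (0%:E <= ereal_sup S)%E.
  apply: le_ereal_sup_tmp; exists (N (D (0, 0)))%:E; first by exists (0, 0).
  by rewrite lee_fin seminorm_ge0.
have Sfin : ereal_sup S \is a fin_num.
  by rewrite ge0_fin_numE // (le_lt_trans Sle) // ltry.
rewrite -(fineK Sfin).
set s := fine _.
have sE : s%:E = ereal_sup S by rewrite /s fineK.
have lin0 (e : R) : (s + e * t)%:E @[t --> 0^'+] --> s%:E.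
  apply: cvg_EFin; first by near=> t.
  apply: cvg_at_right_filter; rewrite -[X in _ --> X]addr0.
  apply: cvgD; first exact: cvg_cst.
  by rewrite -[X in _ --> X](mulr0 e); apply: cvgM; [exact: cvg_cst|exact: cvg_id].
apply: (squeeze_cvge _ (lin0 (- k)) (lin0 k)).
near=> t.
have tdelta : 0 < t < delta.
  by apply/andP; split; near: t; [exact: nbhs_right_gt|exact: nbhs_right_lt].
have /andP[t0 _] := tdelta.
apply/andP; split.
  rewrite mulNr EFinB leeBlDr // sE; apply: ge_ereal_sup => _ [d Pd <-].
  apply: (@le_trans _ _ ((t^-1 * N (tikhonov_change lambda L A b (scale_pert t d)))%:E
                         + (k * t)%:E)%E).
    rewrite -EFinD lee_fin; have := key _ _ tdelta Pd; rewrite ler_norml; lra.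
  rewrite leeD2r //; apply: ereal_sup_ubound.
  by exists (scale_pert t d) => //; apply/Pscale.
apply: ge_ereal_sup => _ [d Pd <-].
have dE : d = scale_pert t (scale_pert t^-1 d).
  by rewrite /scale_pert /= !scalerA divff ?gt_eqF // !scale1r; case: d {Pd}.
have P1d : P 1 (scale_pert t^-1 d) by apply/(Pscale t) => //; rewrite -dE.
apply: (@le_trans _ _ (N (D (scale_pert t^-1 d)) + k * t)%:E).
  rewrite lee_fin {1}dE; have := key _ _ tdelta P1d; rewrite ler_norml; lra.
rewrite !EFinD leeD2r // sE; apply: ereal_sup_ubound.
by exists (scale_pert t^-1 d).
Unshelve. all: by end_near.
Qed.

End WorstCase.

(** * The Frobenius norm *)

Section Frobenius.
Variable R : realType.

Lemma sqr_frobenius m n (X : 'M[R]_(m, n)) :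
  frobenius X ^+ 2 = \sum_i \sum_j X i j ^+ 2.
Proof.
rewrite sqr_sqrtr // sumr_ge0 // => i _.
by rewrite sumr_ge0 // => j _; exact: sqr_ge0.
Qed.

Lemma frobenius_ge0 m n (X : 'M[R]_(m, n)) : 0 <= frobenius X.
Proof. exact: sqrtr_ge0. Qed.

Lemma entry_le_frobenius m n (X : 'M[R]_(m, n)) i j : `|X i j| <= frobenius X.
Proof.
rewrite -(ler_pXn2r (n := 2)) ?nnegrE ?frobenius_ge0 // sqr_frobenius real_normK ?num_real //.
rewrite (bigD1 i) //= (bigD1 j) //= -addrA lerDl addr_ge0 ?sumr_ge0 // => [j' _|i' _].
  exact: sqr_ge0.
by rewrite sumr_ge0 // => j' _; exact: sqr_ge0.
Qed.

Lemma frobenius_row_mx m n1 n2 (X : 'M[R]_(m, n1)) (Y : 'M[R]_(m, n2)) :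
  frobenius (row_mx X Y) ^+ 2 = frobenius X ^+ 2 + frobenius Y ^+ 2.
Proof.
rewrite !sqr_frobenius -big_split; apply: eq_bigr => i _ /=.
rewrite big_split_ord /=.
by congr (_ + _); apply: eq_bigr => j _; rewrite ?row_mxEl ?row_mxEr.
Qed.

Lemma frobenius_col_mx m1 m2 n (X : 'M[R]_(m1, n)) (Y : 'M[R]_(m2, n)) :
  frobenius (col_mx X Y) ^+ 2 = frobenius X ^+ 2 + frobenius Y ^+ 2.
Proof.
rewrite !sqr_frobenius big_split_ord /=.
by congr (_ + _); apply: eq_bigr => i _; apply: eq_bigr => j _;
  rewrite ?col_mxEu ?col_mxEd.
Qed.

Lemma frobeniusZ m n c (X : 'M[R]_(m, n)) :
  frobenius (c *: X) = `|c| * frobenius X.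
Proof.
rewrite /frobenius -sqrtr_sqr -sqrtrM ?sqr_ge0 //; congr Num.sqrt.
rewrite mulr_sumr; apply: eq_bigr => i _; rewrite mulr_sumr.
by apply: eq_bigr => j _; rewrite mxE exprMn.
Qed.

Lemma frobenius_eq0 m n (X : 'M[R]_(m, n)) : frobenius X = 0 -> X = 0.
Proof.
move=> X0; apply/matrixP => i j; rewrite mxE; apply/eqP.
by rewrite -normr_le0 -X0 entry_le_frobenius.
Qed.

(** With [s] and [t] the norms of [X] and [Y], convexity of the square gives
    [(x + y)^2 <= (s + t) (x^2 / s + y^2 / t)] for every pair of entries; these
    bounds sum up to [(s + t)^2]. *)
Lemma frobeniusD_le m n (X Y : 'M[R]_(m, n)) :
  frobenius (X + Y) <= frobenius X + frobenius Y.
Proof.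
have [X0|sn0] := eqVneq (frobenius X) 0.
  by rewrite X0 (frobenius_eq0 X0) !add0r.
have [Y0|tn0] := eqVneq (frobenius Y) 0.
  by rewrite Y0 (frobenius_eq0 Y0) !addr0.
set s := frobenius X; set t := frobenius Y.
have s0 : 0 < s by rewrite lt0r sn0 frobenius_ge0.
have t0 : 0 < t by rewrite lt0r tn0 frobenius_ge0.
rewrite -(ler_pXn2r (n := 2)) ?nnegrE ?frobenius_ge0 ?addr_ge0 ?(ltW s0) ?(ltW t0) //.
have -> : (s + t) ^+ 2 = (s + t) * (s ^+ 2 / s + t ^+ 2 / t).
  by field; rewrite ?gt_eqF.
rewrite !sqr_frobenius !mulr_suml -big_split /= mulr_sumr; apply: ler_sum => i _.
rewrite !mulr_suml -big_split /= mulr_sumr; apply: ler_sum => j _.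
rewrite mxE -subr_ge0.
have -> : (s + t) * (X i j ^+ 2 / s + Y i j ^+ 2 / t) - (X i j + Y i j) ^+ 2 =
    (t * X i j - s * Y i j) ^+ 2 / (s * t).
  by field; rewrite ?gt_eqF.
by rewrite divr_ge0 ?sqr_ge0 // mulr_ge0 // ltW.
Qed.

End Frobenius.

(** * Admissible perturbations *)

Section Perturbation.
Variables (R : realType) (m n k : nat) (S : k.-tuple 'M[R]_(m, n)).
Variables (A : 'M[R]_(m, n)) (a : 'cV[R]_k) (b : 'cV[R]_m).

Lemma lincombB (u v : 'cV[R]_k) : lincomb S (u + v) - lincomb S u = lincomb S v.
Proof.
rewrite /lincomb -sumrB; apply: eq_bigr => i _.
by rewrite mxE scalerDl addrC addKr.
Qed.

Lemma lincombZ c (u : 'cV[R]_k) : lincomb S (c *: u) = c *: lincomb S u.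
Proof.
by rewrite /lincomb scaler_sumr; apply: eq_bigr => i _; rewrite mxE scalerA.
Qed.

Lemma lemx_scale q r (X Y : 'M[R]_(q, r)) t : 0 < t ->
  lemx (absmx (t *: X)) (t *: absmx Y) <-> lemx (absmx X) (1 *: absmx Y).
Proof.
move=> t0; split=> XY i j; have := XY i j;
  by rewrite !mxE normrM gtr0_norm // mul1r ler_pM2l.
Qed.

Lemma entrywise_pert_scale t d : 0 < t ->
  entrywise_pert A b t (scale_pert t d) <-> entrywise_pert A b 1 d.
Proof.
by move=> t0; split=> -[h1 h2]; split; move: h1 h2; rewrite /= !lemx_scale.
Qed.

Lemma struct_entrywise_pert_scale t d : 0 < t ->
  struct_entrywise_pert S a b t (scale_pert t d) <->
  struct_entrywise_pert S a b 1 d.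
Proof.
move=> t0; have tn0 : t != 0 by rewrite gt_eqF.
split=> -[da [h1 h2]] /=; rewrite lincombB => e.
  exists (t^-1 *: da); last by rewrite lincombB lincombZ -e scalerA mulVf // scale1r.
  split; last by move: h2; rewrite /= lemx_scale.
  by rewrite -(lemx_scale _ _ t0) scalerA divff // scale1r.
exists (t *: da); last by rewrite lincombB lincombZ -e.
by rewrite /= !lemx_scale.
Qed.

Lemma normwise_pert_scale t d : 0 < t ->
  normwise_pert A b t (scale_pert t d) <-> normwise_pert A b 1 d.
Proof.
by move=> t0; rewrite /normwise_pert /= -scale_row_mx frobeniusZ gtr0_norm //
  mul1r ler_pM2l.
Qed.

Lemma struct_normwise_pert_scale t d : 0 < t ->
  struct_normwise_pert S a b t (scale_pert t d) <->
  struct_normwise_pert S a b 1 d.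
Proof.
move=> t0; have tn0 : t != 0 by rewrite gt_eqF.
split=> -[da h] /=; rewrite lincombB => e.
  exists (t^-1 *: da); last by rewrite lincombB lincombZ -e scalerA mulVf // scale1r.
  rewrite mul1r -(ler_pM2l t0) -{1}(gtr0_norm t0) -frobeniusZ scale_col_mx.
  by rewrite scalerA divff // scale1r.
exists (t *: da); last by rewrite lincombB lincombZ -e.
by rewrite /= -scale_col_mx frobeniusZ gtr0_norm // ler_pM2l // -[leRHS]mul1r.
Qed.

Lemma entrywise_pert0 : entrywise_pert A b 1 (0, 0).
Proof. by split=> i j; rewrite !mxE normr0 mul1r. Qed.

Lemma struct_entrywise_pert0 : struct_entrywise_pert S a b 1 (0, 0).
Proof.
exists 0; last by rewrite addr0 subrr.
by split=> i j; rewrite !mxE normr0 mul1r.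
Qed.

Lemma normwise_pert0 : normwise_pert A b 1 (0, 0).
Proof.
rewrite /normwise_pert /= row_mx0 -(scale0r (row_mx A b)) frobeniusZ.
by rewrite normr0 mul0r mul1r frobenius_ge0.
Qed.

Lemma struct_normwise_pert0 : struct_normwise_pert S a b 1 (0, 0).
Proof.
exists 0; last by rewrite addr0 subrr.
rewrite /= col_mx0 -(scale0r (col_mx a b)) frobeniusZ.
by rewrite normr0 mul0r mul1r frobenius_ge0.
Qed.

Lemma norm_entrywise_pert_le d :
  entrywise_pert A b 1 d -> `|d.1| <= `|A| + `|b| /\ `|d.2| <= `|A| + `|b|.
Proof.
move=> [h1 h2]; split; apply: norm_le_entries => [|i j];
  rewrite ?addr_ge0 //.
  have := h1 i j; rewrite !mxE mul1r => /le_trans; apply.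
  by rewrite (le_trans (entry_le_norm _ _ _)) // lerDl.
have := h2 i j; rewrite !mxE mul1r => /le_trans; apply.
by rewrite (le_trans (entry_le_norm _ _ _)) // lerDr.
Qed.

Lemma norm_le_frobenius_row_mx d c : frobenius (row_mx d.1 d.2) <= c ->
  `|d.1 : 'M[R]_(m, n)| <= c /\ `|d.2 : 'cV[R]_m| <= c.
Proof.
move=> dc; have c0 : 0 <= c by rewrite (le_trans (frobenius_ge0 _) dc).
split; apply: norm_le_entries => // i j; apply: le_trans dc.
  by rewrite -(row_mxEl d.1 d.2) entry_le_frobenius.
by rewrite -(row_mxEr d.1 d.2) entry_le_frobenius.
Qed.

(** The expansion of [|lincomb S a|] over the basis yields
    [|lincomb S da| <= \sum |da_i| |S_i| <= \sum |a_i| |S_i| = |lincomb S a|]. *)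
Lemma struct_entrywise_pert_sub :
  absmx (lincomb S a) = \sum_(i < k) `|a i 0| *: absmx (tnth S i) ->
  struct_entrywise_pert S a b 1 `<=` entrywise_pert (lincomb S a) b 1.
Proof.
move=> Sabs d [da [h1 h2]]; rewrite lincombB => e; split=> // i j.
rewrite Sabs e scale1r mxE /lincomb !summxE.
rewrite (le_trans (ler_norm_sum _ _ _)) // ler_sum // => t _.
rewrite !mxE normrM ler_wpM2r //.
by have := h1 t 0; rewrite !mxE mul1r.
Qed.

End Perturbation.

(** * Toeplitz and Hankel bases *)

Section DisjointSupport.
Variable R : realType.

(** The matrices of the family have pairwise disjoint supports, and each of them
    has Frobenius norm at least 1. *)
Definition disjoint_basis m n k (S : k.-tuple 'M[R]_(m, n)) : Prop :=
  (forall s t i j, s != t -> tnth S s i j * tnth S t i j = 0) /\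
  (forall t, 1 <= frobenius (tnth S t)).

Lemma frobenius_lincomb m n k (S : k.-tuple 'M[R]_(m, n)) (a : 'cV[R]_k) :
  disjoint_basis S ->
  frobenius (lincomb S a) ^+ 2 =
  \sum_t a t 0 ^+ 2 * frobenius (tnth S t) ^+ 2.
Proof.
move=> [disj _]; under eq_bigr do rewrite sqr_frobenius mulr_sumr.
rewrite sqr_frobenius [RHS]exchange_big /=; apply: eq_bigr => i _.
under [RHS]eq_bigr do rewrite mulr_sumr.
rewrite [RHS]exchange_big /=; apply: eq_bigr => j _.
rewrite /lincomb summxE expr2 mulr_suml; apply: eq_bigr => s _.
rewrite mulr_sumr (bigD1 s) //= [X in _ + X]big1 ?addr0 => [|t ts].
  by rewrite !mxE; ring.
by rewrite !mxE mulrACA disj ?mulr0 // eq_sym.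
Qed.

(** If [d.1 = lincomb S da], then the square of the left-hand side is at most
    [C^2 (|da|^2 + |d.2|^2) <= C^2 (|a|^2 + |b|^2)], and [|a|] is at most
    [|lincomb S a|_F] because the basis matrices have norm at least 1. *)
Lemma struct_normwise_pert_bound m n k (S : k.-tuple 'M[R]_(m, n))
    (a : 'cV[R]_k) (b : 'cV[R]_m) (C : R) d :
  disjoint_basis S -> 1 <= C -> (forall t, frobenius (tnth S t) <= C) ->
  struct_normwise_pert S a b 1 d ->
  frobenius (row_mx d.1 d.2) <= C * frobenius (row_mx (lincomb S a) b).
Proof.
move=> disj C1 SC [da]; rewrite lincombB mul1r => dale ->.
have C0 : 0 <= C by exact: le_trans C1.
rewrite -(ler_pXn2r (n := 2)) ?nnegrE ?mulr_ge0 ?frobenius_ge0 //.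
rewrite exprMn !frobenius_row_mx !frobenius_lincomb //.
have C2 : 1 <= C ^+ 2 by rewrite exprn_ege1.
have sqr_col q (u : 'cV[R]_q) : frobenius u ^+ 2 = \sum_t u t 0 ^+ 2.
  by rewrite sqr_frobenius; apply: eq_bigr => t _; rewrite big_ord1.
have dS : \sum_t da t 0 ^+ 2 * frobenius (tnth S t) ^+ 2 <= C ^+ 2 * frobenius da ^+ 2.
  rewrite sqr_col mulr_sumr ler_sum // => t _.
  rewrite mulrC ler_wpM2r ?sqr_ge0 // ler_pXn2r ?nnegrE ?frobenius_ge0 //.
have aS : frobenius a ^+ 2 <= \sum_t a t 0 ^+ 2 * frobenius (tnth S t) ^+ 2.
  rewrite sqr_col ler_sum // => t _.
  by rewrite ler_peMr ?sqr_ge0 // exprn_ege1 // disj.2.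
have dd : frobenius d.2 ^+ 2 <= C ^+ 2 * frobenius d.2 ^+ 2.
  by rewrite ler_peMl // sqr_ge0.
have {}dale : frobenius (col_mx da d.2) ^+ 2 <= frobenius (col_mx a b) ^+ 2.
  by rewrite ler_pXn2r ?nnegrE ?frobenius_ge0.
rewrite !frobenius_col_mx in dale.
apply: (le_trans (lerD dS dd)); rewrite -mulrDr ler_wpM2l ?sqr_ge0 //.
by apply: le_trans dale _; rewrite lerD2r.
Qed.

(** 0-1 matrices, the [t]-th one being the indicator of [f t], have disjoint
    supports when at most one [t] satisfies [f t i j] for given [i] and [j].
    Freeness makes them distinct and nonzero; a nonzero one has an entry 1. *)
Lemma indicator_basis_disjoint m n k (S : k.-tuple 'M[R]_(m, n)) (r : seq nat)
    (f : nat -> 'I_m -> 'I_n -> bool) :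
  (forall s t i j, f s i j -> f t i j -> s = t) -> free S ->
  perm_eq S [seq \matrix_(i, j) (f t i j)%:R | t <- r] ->
  disjoint_basis S.
Proof.
move=> finj freeS permS.
have SE t : exists s, tnth S t = \matrix_(i, j) (f s i j)%:R.
  have : tnth S t \in [seq \matrix_(i, j) (f t i j)%:R | t <- r].
    by rewrite -(perm_mem permS) mem_tnth.
  by move=> /mapP[s _ ->]; exists s.
split=> [s t i j st|t].
  have : tnth S s != tnth S t.
    rewrite !(tnth_nth 0) nth_uniq ?size_tuple //; exact: free_uniq.
  have [s' ->] := SE s; have [t' ->] := SE t; rewrite !mxE.
  case fs : (f s' i j); last by rewrite mul0r.
  case ft : (f t' i j); last by rewrite mulr0.
  by rewrite (finj _ _ _ _ fs ft) eqxx.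
have : tnth S t != 0.
  exact: free_not0 freeS (mem_tnth t S).
have [s ->] := SE t; set X := (X in X != 0) => X0.
have [i [j fij]] : exists i j, f s i j.
  apply: contrapT => h; move/eqP: X0; apply; apply/matrixP => i j; rewrite !mxE.
  by case fij : (f s i j) => //; case: h; exists i, j.
by rewrite (le_trans _ (entry_le_frobenius X i j)) // mxE fij normr1.
Qed.

Lemma standard_basis_disjoint m n k (V : {vspace 'M[R]_(m, n)})
    (S : k.-tuple 'M[R]_(m, n)) :
  basis_of V S -> standard_toeplitz V S \/ standard_hankel V S ->
  disjoint_basis S.
Proof.
move=> /basis_free freeS [[_ permS]|[_ permS]].
  apply: (indicator_basis_disjoint
    (f := fun t i j => i + n.-1 == t + j)%N) freeS permS => s t i j.
  by move=> /eqP -> /eqP /addIn.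
apply: (indicator_basis_disjoint
  (f := fun t i j => i + j == t)%N) freeS permS => s t i j.
by move=> /eqP -> /eqP.
Qed.

End DisjointSupport.

(** * Comparison of the condition numbers *)

Section Ratios.
Variables (R : realType) (n l : nat) (M : 'M[R]_(l, n)) (z : 'cV[R]_l).

Lemma seminorm_mixed : seminorm (fun u => `|M *m u| / `|z|).
Proof.
split=> [u v|c u]; first by rewrite mulmxDr -mulrDl ler_wpM2r // ler_normD.
by rewrite -scalemxAr normrZ mulrA.
Qed.

Lemma seminorm_componentwise : seminorm (fun u => `|divmx (M *m u) z|).
Proof.
split=> [u v|c u].
  have -> : divmx (M *m (u + v)) z = divmx (M *m u) z + divmx (M *m v) z.
    by apply/matrixP => i j; rewrite mulmxDr !mxE mulrDl.
  exact: ler_normD.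
rewrite -normrZ -scalemxAr; congr `|_|.
by apply/matrixP => i j; rewrite !mxE mulrA.
Qed.

Lemma seminorm_normwise : seminorm (fun u => frobenius (M *m u) / frobenius z).
Proof.
split=> [u v|c u].
  by rewrite mulmxDr -mulrDl ler_wpM2r ?invr_ge0 ?frobenius_ge0 // frobeniusD_le.
by rewrite -scalemxAr frobeniusZ mulrA.
Qed.

End Ratios.

Section Comparison.
Variables (R : realType) (m n p : nat) (lambda : R) (L : 'M[R]_(p, n)).
Variables (A : 'M[R]_(m, n)) (b : 'cV[R]_m).
Hypothesis Gu : gram lambda L A \in unitmx.
Variable N : 'cV[R]_n -> R.
Hypothesis semiN : seminorm N.

Local Notation ratio :=
  (fun t d => t^-1 * N (tikhonov_change lambda L A b d)).
Local Notation lim_sup P := (lim (worst ratio P t @[t --> 0^'+])).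

Lemma entrywise_comparison k (S : k.-tuple 'M[R]_(m, n)) (a : 'cV[R]_k) :
  A = lincomb S a ->
  absmx (lincomb S a) = \sum_(i < k) `|a i 0| *: absmx (tnth S i) ->
  [/\ cvg (worst ratio (struct_entrywise_pert S a b) t @[t --> 0^'+]),
      cvg (worst ratio (entrywise_pert A b) t @[t --> 0^'+])
    & (lim_sup (struct_entrywise_pert S a b) <= lim_sup (entrywise_pert A b))%E].
Proof.
move=> AS /(struct_entrywise_pert_sub (b := b)) sub; rewrite -AS in sub.
have str := worst_cvg (b := b) Gu semiN
  (fun t d => @struct_entrywise_pert_scale _ _ _ _ S a b t d)
  (struct_entrywise_pert0 S a b)
  (fun d Pd => norm_entrywise_pert_le (sub d Pd)).
have uns := worst_cvg (b := b) Gu semiN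
  (fun t d => @entrywise_pert_scale _ _ _ A b t d)
  (entrywise_pert0 A b) (@norm_entrywise_pert_le _ _ _ A b).
split; [exact: cvgP str|exact: cvgP uns|].
rewrite (cvg_lim _ str) // (cvg_lim _ uns) //.
by apply: ereal_sup_le => _ [d /sub Pd <-]; exists d.
Qed.

(** With [C] the largest of 1 and the norms of the basis matrices, a structured
    unit perturbation is [C] times an unstructured one, and the derivative is
    homogeneous; so already the factor [C] is enough. *)
Lemma normwise_comparison k (S : k.-tuple 'M[R]_(m, n)) (a : 'cV[R]_k) :
  A = lincomb S a -> disjoint_basis S ->
  [/\ cvg (worst ratio (struct_normwise_pert S a b) t @[t --> 0^'+]),
      cvg (worst ratio (normwise_pert A b) t @[t --> 0^'+])
    & (lim_sup (struct_normwise_pert S a b) <=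
       (Num.sqrt 2 *
        Num.max (\big[Num.max/0]_(i < k) frobenius (tnth S i)) 1)%:E *
       lim_sup (normwise_pert A b))%E].
Proof.
move=> AS disj; set C := Num.max _ 1.
have C1 : 1 <= C by rewrite le_max lexx orbT.
have C0 : 0 < C by exact: lt_le_trans C1.
have SC t : frobenius (tnth S t) <= C.
  by rewrite le_max; apply/orP; left; apply/bigmax_geP; right; exists t.
have bound d : struct_normwise_pert S a b 1 d ->
    frobenius (row_mx d.1 d.2) <= C * frobenius (row_mx A b).
  by rewrite AS; exact: struct_normwise_pert_bound.
have str := worst_cvg (b := b) Gu semiN
  (fun t d => @struct_normwise_pert_scale _ _ _ _ S a b t d)
  (struct_normwise_pert0 S a b)
  (fun d Pd => norm_le_frobenius_row_mx (bound d Pd)).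
have uns := worst_cvg (b := b) Gu semiN
  (fun t d => @normwise_pert_scale _ _ _ A b t d)
  (normwise_pert0 A b) (@norm_le_frobenius_row_mx _ _ _ ^~ _).
split; [exact: cvgP str|exact: cvgP uns|].
rewrite (cvg_lim _ str) // (cvg_lim _ uns) //.
apply: ge_ereal_sup => _ [d Pd <-].
set d' := scale_pert C^-1 d.
have dE : d = scale_pert C d'.
  by rewrite /d' /scale_pert /= !scalerA divff ?gt_eqF // !scale1r; case: d {Pd d'}.
have Pd' : normwise_pert A b 1 d'.
  rewrite /normwise_pert /= -scale_row_mx frobeniusZ gtr0_norm ?invr_gt0 //.
  by rewrite mul1r ler_pdivrMl // bound.
have s21 : 1 <= Num.sqrt 2 :> R by rewrite -[leLHS]sqrtr1 ler_sqrt // ler1n.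
rewrite dE tikhonov_diff_scale semiN.2 gtr0_norm //.
apply: (@le_trans _ _ ((Num.sqrt 2 * C)%:E * (N (tikhonov_diff lambda L A b d'))%:E)%E).
  by rewrite -EFinM lee_fin ler_wpM2r ?seminorm_ge0 // ler_peMl // ltW.
apply: lee_wpmul2l; first by rewrite lee_fin mulr_ge0 // ltW.
by apply: ereal_sup_ubound; exists d'.
Qed.

End Comparison.

Lemma worst_ext (R : realType) m n (r1 r2 : R -> perturbation R m n -> R) :
  (forall t d, r1 t d = r2 t d) -> worst r1 = worst r2.
Proof. by move=> r12; congr worst; apply/funext => t; apply/funext => d. Qed.

Theorem proposition1 (R : realType) (m n p l k : nat) (lambda : R)
    (L : 'M[R]_(p, n)) (M : 'M[R]_(l, n)) (A : 'M[R]_(m, n)) (b : 'cV[R]_m)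
    (V : {vspace 'M[R]_(m, n)}) (S : k.-tuple 'M[R]_(m, n)) (a : 'cV[R]_k) :
  0 < lambda ->
  \rank L = p -> (p <= n)%N -> (n <= m)%N ->
  \rank (col_mx A L) = n ->
  (l <= n)%N ->
  basis_of V S -> A = lincomb S a ->
  M *m tikhonov lambda L A b != 0 ->
  ((forall (B : 'M[R]_(m, n)) (beta : 'cV[R]_k), B = lincomb S beta ->
      absmx B = \sum_(i < k) `|beta i 0| *: absmx (tnth S i)) ->
   [/\ cvg (m_Reg_struct_sup lambda L M S a b eps @[eps --> 0^'+]),
       cvg (m_Reg_sup lambda L M A b eps @[eps --> 0^'+])
     & (m_Reg_struct lambda L M S a b <= m_Reg lambda L M A b)%E] /\
   ((forall i : 'I_l, (M *m tikhonov lambda L A b) i 0 != 0) ->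
    [/\ cvg (c_Reg_struct_sup lambda L M S a b eps @[eps --> 0^'+]),
        cvg (c_Reg_sup lambda L M A b eps @[eps --> 0^'+])
      & (c_Reg_struct lambda L M S a b <= c_Reg lambda L M A b)%E])) /\
  (standard_toeplitz V S \/ standard_hankel V S ->
   [/\ cvg (kappa_Reg_struct_sup lambda L M S a b eps @[eps --> 0^'+]),
       cvg (kappa_Reg_sup lambda L M A b eps @[eps --> 0^'+])
     & (kappa_Reg_struct lambda L M S a b <=
        (Num.sqrt 2 *
         Num.max (\big[Num.max/0]_(i < k) frobenius (tnth S i)) 1)%:E *
        kappa_Reg lambda L M A b)%E]).
Proof.
move=> l0 _ _ _ rk _ basisS AS _.
have Gu := gram_unitmx l0 rk.
set z := M *m tikhonov lambda L A b.
have mE : worst (mixed_ratio lambda L M A b) = worst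
    (fun t d => t^-1 * (`|M *m tikhonov_change lambda L A b d| / `|z|)).
  by apply: worst_ext => t d; rewrite /mixed_ratio invfM mulrCA.
have kE : worst (normwise_ratio lambda L M A b) = worst
    (fun t d => t^-1 * (frobenius (M *m tikhonov_change lambda L A b d) / frobenius z)).
  by apply: worst_ext => t d; rewrite /normwise_ratio invfM mulrCA.
split=> [Sabs|basis_std].
  have absA := Sabs _ a erefl.
  split=> [|_].
    rewrite /m_Reg_struct /m_Reg /m_Reg_struct_sup /m_Reg_sup -AS mE.
    exact: (entrywise_comparison b Gu (seminorm_mixed M z) AS absA).
  rewrite /c_Reg_struct /c_Reg /c_Reg_struct_sup /c_Reg_sup -AS.
  exact: (entrywise_comparison b Gu (seminorm_componentwise M z) AS absA).
rewrite /kappa_Reg_struct /kappa_Reg /kappa_Reg_struct_sup /kappa_Reg_sup -AS kE.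
exact: (normwise_comparison b Gu (seminorm_normwise M z) AS
  (standard_basis_disjoint basisS basis_std)).
Qed.
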